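(* Let $q=p^n$ with $p$ prime and $n\ge 1$. For integers $d\ge 1$ and $k\ge 1$, let $S_k(d)$ be the number of normalized polynomials in $\mathbb{F}_q[x,y]$ of degree exactly $d$ having exactly $k$ irreducible (not necessarily distinct) factors, i.e. which are products of exactly $k$ irreducible polynomials counted with multiplicity. Let $I(d)$ be the number of normalized irreducible polynomials in $\mathbb{F}_q[x,y]$ of degree exactly $d$. Then $$S_k(d)=\sum_{[d_1,\ldots,d_k]\in\mathcal{P}(k,d)} I(d_1)\otimes I(d_2)\otimes\cdots\otimes I(d_k).$$
   Context: $\mathbb{F}_q$ is the finite field with $q$ elements; degree means total degree. A polynomial $f(x,y)=\alpha_0x^d+\alpha_1x^{d-1}y+\alpha_2x^{d-2}y^2+\cdots+\alpha_dy^d+(\text{terms of lower degree})$ of degree exactly $d$ is normalized if the first non-zero term of the sequence $(\alpha_0,\alpha_1,\ldots,\alpha_d)$ is equal to $1$. $\mathcal{P}(k,d)$ is the set of partitions of $d$ into exactly $k$ parts: $\mathcal{P}(k,d)=\{[d_1,\ldots,d_k] \mid 1\le d_1\le d_2\le\cdots\le d_k,\ d_1+\cdots+d_k=d\}$ (the $d_i$ are integers). The product $\otimes$: let $(\ell_1,\ldots,\ell_k)\in\mathbb{N}^k$ be a nondecreasing sequence, grouped into maximal blocks of equal values $\ell_{i_1}=\cdots=\ell_{i_1+\alpha_1-1}<\ell_{i_2}=\cdots=\ell_{i_2+\alpha_2-1}<\cdots<\ell_{i_r}=\cdots=\ell_k$, where $i_1=1$ and the $j$-th block has length $\alpha_j$.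 Then $$\ell_1\otimes\ell_2\otimes\cdots\otimes\ell_k=\binom{\ell_{i_1}+\alpha_1-1}{\alpha_1}\times\binom{\ell_{i_2}+\alpha_2-1}{\alpha_2}\times\cdots\times\binom{\ell_{i_r}+\alpha_r-1}{\alpha_r}.$$ *)

(* Defs.v *)
From HB Require Import structures.
From mathcomp Require Import all_boot all_order all_algebra.
From mathcomp Require Import finmap boolp classical_sets functions cardinality.
From mathcomp Require Import mpoly.

Set Implicit Arguments.
Unset Strict Implicit.
Unset Printing Implicit Defensive.

Import GRing.Theory.

Local Open Scope ring_scope.

Definition irreducible_elt (R : unitRingType) (p : R) : Prop :=
  [/\ p != 0, p \isn't a GRing.unit &
      forall a b : R, p = a * b -> a \is a GRing.unit \/ b \is a GRing.unit].

Section Bivariate.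
Variable F : finFieldType.

(* msize is the total degree plus one, and 0 for the zero polynomial. *)
Definition has_degree (d : nat) (p : {mpoly F[2]}) : Prop := msize p = d.+1.

(* The coefficients alpha_0, ..., alpha_d of x^d, x^(d-1) y, ..., y^d, where the
   variables of index 0 and 1 are x and y. *)
Definition top_coefs (d : nat) (p : {mpoly F[2]}) : seq F :=
  mkseq (fun i => p@_[multinom [tuple (d - i)%N; i]]) d.+1.

(* The default 0 of head is only reached when all the coefficients vanish. *)
Definition normalized (d : nat) (p : {mpoly F[2]}) : Prop :=
  head 0 [seq a <- top_coefs d p | a != 0] = 1.

Definition has_k_factors (k : nat) (p : {mpoly F[2]}) : Prop :=
  exists s : k.-tuple {mpoly F[2]},
    (forall f, f \in s -> irreducible_elt f) /\ p = \prod_(f <- s) f.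

Definition normalized_of_degree (d : nat) : set {mpoly F[2]} :=
  [set p | has_degree d p /\ normalized d p]%classic.

(* fset_set sends infinite sets to the empty finite set; this lemma ensures that
   the cardinals below are genuine ones. *)
Lemma finite_normalized_of_degree (d : nat) :
  finite_set (normalized_of_degree d).
Proof.
pose g (c : {ffun 'X_{1..2 < d.+1} -> F}) : {mpoly F[2]} :=
  \sum_(m : 'X_{1..2 < d.+1}) c m *: 'X_[m].
apply: (@sub_finite_set _ _ (g @` setT)%classic); last first.
  by apply: finite_image; exact: finite_finset.
move=> p [sp _]; exists [ffun m : 'X_{1..2 < d.+1} => p@_m] => //.
rewrite /g [RHS](@mpolywE _ _ d.+1) ?sp //.
by apply: eq_bigr => m _; rewrite ffunE.
Qed.

Definition S_ (k d : nat) : nat :=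
  #|` fset_set (normalized_of_degree d `&`
        [set p | has_k_factors k p])%classic |.

Definition I_ (d : nat) : nat :=
  #|` fset_set (normalized_of_degree d `&`
        [set p | irreducible_elt p])%classic |.

End Bivariate.

(* A part d_i is at most d, hence an element of 'I_d.+1. *)
Definition partitions (k d : nat) : {set k.-tuple 'I_d.+1} :=
  [set t : k.-tuple 'I_d.+1 |
    let s := [seq val i | i <- t] in
    [&& all (leq 1) s, sorted leq s & sumn s == d]].

(* In a nondecreasing sequence the maximal blocks of equal values correspond to
   the distinct values l, and the length of a block is the multiplicity of l.
   That multiplicity is positive, so the predecessor is an exact subtraction. *)
Definition otimes (s : seq nat) : nat :=
  (\prod_(l <- undup s) 'C((l + count_mem l s).-1, count_mem l s))%N.

(* Main.v *)
Require Import Defs.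
From HB Require Import structures.
From mathcomp Require Import all_boot all_order all_algebra all_fingroup all_field.
From mathcomp Require Import finmap boolp classical_sets functions cardinality.
From mathcomp Require Import mpoly.

(* By unique factorization in F[x, y], a normalized polynomial with k factors is a
   multiset of k normalized irreducible polynomials.  The degrees of its elements
   form a partition of d, and a partition in which e occurs c_e times arises from
   prod_e 'C(I(e) + c_e - 1, c_e) multisets.  Since [otimes] groups equal values of
   I rather than equal degrees, it computes this product only because I is
   injective.  In fact I(d) < I(d + 1): if u is irreducible of degree d + 1 in F[x]
   and h is its homogenization, then h + g is irreducible for every g of degree at
   most d, while the polynomials counted by I(d) are among the nonzero such g. *)

Set Implicit Arguments.
Unset Strict Implicit.
Unset Printing Implicit Defensive.

Import GRing.Theory.

(** * Counting multisets by degree *)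

Section Multisets.
Variables (T : finType) (k : nat).
Implicit Types f g : {ffun T -> 'I_k.+1}.

(** A multiset over [T] is encoded by its multiplicity function; the bound [k] keeps the type of
    multisets finite. *)
Definition seq_of_mult f : seq T := flatten [seq nseq (f x) x | x <- enum T].

Lemma count_seq_of_mult f (P : pred T) :
  count P (seq_of_mult f) = \sum_(x | P x) f x.
Proof.
rewrite count_flatten sumnE -map_comp big_map big_enum /=.
rewrite [RHS]big_mkcond; apply: eq_bigr => x _.
by rewrite count_nseq; case: (P x); rewrite ?mul1n.
Qed.

Lemma count_mem_seq_of_mult f x : count_mem x (seq_of_mult f) = f x.
Proof. by rewrite count_seq_of_mult big_pred1_eq. Qed.

Lemma seq_of_mult_inj f g : perm_eq (seq_of_mult f) (seq_of_mult g) -> f = g.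
Proof.
move=> /seq.permP eq_fg; apply/ffunP => x; apply: val_inj => /=.
by rewrite -!count_mem_seq_of_mult eq_fg.
Qed.

Lemma seq_of_mult_count (s : seq T) : (size s <= k)%N ->
  perm_eq (seq_of_mult [ffun x => inord (count_mem x s)]) s.
Proof.
move=> size_s; apply/allP => x _; rewrite /= count_mem_seq_of_mult ffunE inordK //.
by rewrite ltnS (leq_trans (count_size _ _)).
Qed.

(** Stars and bars: the multiplicities along [enum A] form a tuple of sum [c], and
    [card_ord_partitions] counts such tuples. *)
Lemma card_multisets (A : {set T}) (c : nat) : (c <= k)%N ->
  #|[set f : {ffun T -> 'I_k.+1} |
      [forall x, (x \notin A) ==> (f x == ord0)] && (\sum_x f x == c)%N]|
  = 'C((#|A| + c).-1, c).
Proof.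
(* The empty [A] is treated apart, since the tuples have length [m.+1]. It supports one multiset if
   [c] is 0, where the predecessor truncates, and none otherwise, where the binomial vanishes. *)
move=> le_ck; have [cardA0|/card_gt0P[x0 Ax0]] := posnP #|A|.
  have A0 x : x \in A = false by rewrite (card0_eq cardA0).
  rewrite cardA0 add0n; have [->|c_gt0] := posnP c.
    rewrite bin0; apply/eqP/cards1P; exists [ffun=> ord0]; apply/setP => f; rewrite !inE.
    apply/andP/eqP => [[/forallP f0 _]|->].
      by apply/ffunP => x; have := f0 x; rewrite A0 ffunE => /eqP.
    rewrite big1 => [|x _]; last by rewrite ffunE.
    by split=> //; apply/forallP => x; rewrite ffunE eqxx implybT.
  rewrite bin_small ?prednK //; apply: eq_card0 => f; rewrite !inE.
  apply/negP => /andP[/forallP f0]; rewrite big1 => [|x _].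
    by rewrite eq_sym -leqn0 leqNgt c_gt0.
  by have := f0 x; rewrite A0 => /eqP->.
have [m mE] : exists m, #|A| = m.+1 by exists #|A|.-1; rewrite prednK // (cardD1 x0) Ax0.
have -> : 'C((#|A| + c).-1, c) = 'C(m + c, m).
  by rewrite mE addSn /= -[in RHS]bin_sub ?leq_addr // addKn.
rewrite -card_ord_partitions.
(* Outside [A] the index equals the length of [t], so [nth] returns its default [ord0] and [G t] is
   supported on [A]. *)
pose G (t : m.+1.-tuple 'I_c.+1) : {ffun T -> 'I_k.+1} :=
  [ffun x => inord (nth ord0 t (index x (enum A)))].
have GE t x : G t x = nth ord0 t (index x (enum A)) :> nat.
  by rewrite ffunE inordK // (leq_trans (ltn_ord _)).
have size_A : size (enum A) = m.+1 by rewrite -cardE.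
have index_A i : (i < m.+1)%N -> index (nth x0 (enum A) i) (enum A) = i.
  by move=> lt_im; rewrite index_uniq ?enum_uniq ?size_A.
have G_inj : injective G.
  move=> t t' eq_tt'; apply/eq_from_tnth => i; apply: val_inj.
  rewrite /= !(tnth_nth ord0).
  by rewrite -{1}(index_A i) // -GE eq_tt' GE index_A.
have sum_G t : \sum_x G t x = \sum_(i <- t) i.
  rewrite (bigID (fun x => x \in A)) /= [X in (_ + X)%N]big1 => [|x nAx]; last first.
    by rewrite GE memNindex ?mem_enum // nth_default // size_tuple size_A.
  rewrite addn0 -big_enum (big_nth x0) size_A [RHS](big_nth ord0) size_tuple.
  by rewrite !big_nat; apply: eq_bigr => i /= lt_im; rewrite GE index_A.
rewrite -(card_imset _ G_inj); apply: eq_card => f; rewrite !inE.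
apply/andP/imsetP => [[/forallP f0 /eqP sum_f]|[t]]; last first.
  rewrite inE => /eqP sum_t ->; rewrite sum_G sum_t; split=> //.
  apply/forallP => x; apply/implyP => nAx; apply/eqP/val_inj => /=.
  by rewrite GE memNindex ?mem_enum // nth_default // size_tuple size_A.
have le_fc x : (f x <= c)%N by rewrite -sum_f (bigD1 x) //= leq_addr.
pose t := [tuple inord (f (nth x0 (enum A) i)) | i < m.+1] : m.+1.-tuple 'I_c.+1.
have Gt : G t = f.
  apply/ffunP => x; apply: val_inj; rewrite /= GE.
  have [Ax|nAx] := boolP (x \in A); last first.
    rewrite memNindex ?mem_enum // size_A nth_default ?size_tuple //.
    by have := f0 x; rewrite nAx => /eqP->.
  have lt_xm : (index x (enum A) < m.+1)%N by rewrite -size_A index_mem mem_enum.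
  rewrite -[index _ _]/(val (Ordinal lt_xm)) -tnth_nth tnth_mktuple inordK ?ltnS //=.
  by rewrite nth_index ?mem_enum.
by exists t => //; rewrite inE -sum_G Gt sum_f.
Qed.

(** The fibres of [w] partition [T], so a multiset amounts to an independent choice of one multiset
    on each fibre, and the counts multiply. *)
Lemma card_multisets_profile (I : finType) (w : T -> I) (c : I -> nat) :
  (forall e, c e <= k)%N ->
  #|[set f : {ffun T -> 'I_k.+1} | [forall e, \sum_(x | w x == e) f x == c e]]|
  = \prod_e 'C((#|[set x | w x == e]| + c e).-1, c e).
Proof.
move=> le_ck.
pose Fam e := [set f : {ffun T -> 'I_k.+1} |
  [forall x, (x \notin [set x | w x == e]) ==> (f x == ord0)] && (\sum_x f x == c e)].
under eq_bigr do rewrite -card_multisets //.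
have -> : \prod_e #|Fam e| = #|family Fam|.
  by rewrite card_family foldrE big_map big_enum.
pose split f : {ffun I -> {ffun T -> 'I_k.+1}} :=
  [ffun e => [ffun x => if w x == e then f x else ord0]].
have split_inj : injective split.
  move=> f g /ffunP eq_fg; apply/ffunP => x.
  by have /ffunP/(_ x) := eq_fg (w x); rewrite !ffunE eqxx.
have sum_split f e : \sum_x split f e x = \sum_(x | w x == e) f x.
  rewrite [RHS]big_mkcond; apply: eq_bigr => x _; rewrite !ffunE.
  by case: ifP.
rewrite -(card_imset _ split_inj); apply: eq_card => g.
apply/imsetP/familyP => [[f] |gFam].
  rewrite inE => /forallP f_c -> e; rewrite inE sum_split f_c andbT.
  by apply/forallP => x; rewrite inE !ffunE; case: eqP.
have gE : split [ffun x => g (w x) x] = g.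
  apply/ffunP => e; apply/ffunP => x; rewrite !ffunE.
  case: eqVneq => [-> //|neq_e].
  have := gFam e; rewrite inE => /andP[/forallP/(_ x)].
  by rewrite inE neq_e => /eqP->.
exists [ffun x => g (w x) x] => //; rewrite inE; apply/forallP => e.
by rewrite -sum_split gE; have := gFam e; rewrite inE => /andP[].
Qed.

(** The sorted weights of a multiset of size [k] and total weight [d] form a partition [t] of [d].
    The multisets over [t] are those having, for each [e], as many elements of weight [e] as [t] has
    parts equal to [e]. *)
Lemma card_multisets_partition (d : nat) (w : T -> 'I_d.+1) : (forall x, 0 < w x)%N ->
  #|[set f : {ffun T -> 'I_k.+1} | (size (seq_of_mult f) == k) &&
      (\sum_(x <- seq_of_mult f) w x == d)%N]|
  = \sum_(t in partitions k d)
      \prod_e 'C((#|[set x | w x == e]| + count_mem e t).-1, count_mem e t).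
Proof.
move=> w_gt0; pose leo : rel 'I_d.+1 := relpre val leq.
have leo_trans : transitive leo by move=> ? ? ?; apply: leq_trans.
have leo_anti : antisymmetric leo.
  by move=> i j /anti_leq; apply: val_inj.
pose s f := sort leo [seq w x | x <- seq_of_mult f].
have count_s f e : count_mem e (s f) = \sum_(x | w x == e) f x.
  by rewrite count_sort count_map count_seq_of_mult.
have size_s f : size (s f) = size (seq_of_mult f) by rewrite size_sort size_map.
have sum_s f : sumn [seq nat_of_ord i | i <- s f] = \sum_(x <- seq_of_mult f) w x.
  by rewrite sumnE big_map (perm_big _ (introT permPl (perm_sort _ _))) /= big_map.
(* The default tuple is reached only by multisets whose size is not [k]. *)
pose P f : k.-tuple 'I_d.+1 := insubd (nseq_tuple k ord0) (s f).
have PE f : size (seq_of_mult f) = k -> P f = s f :> seq _.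
  by move=> size_f; rewrite val_insubd size_s size_f eqxx.
rewrite -sum1_card (partition_big P (fun t => t \in partitions k d)) => [|f].
  apply: eq_bigr => t; rewrite inE /= => /and3P[_ t_sorted /eqP sum_t].
  rewrite -card_multisets_profile => [|e]; last first.
    by rewrite -[leqRHS](size_tuple t) count_size.
  rewrite -sum1_card; apply: eq_bigl => f; rewrite !inE.
  apply/andP/forallP => [[/andP[/eqP size_f _] /eqP <-] e|f_t].
    by rewrite PE // count_s.
  have st : s f = t.
    apply: (sorted_eq leo_trans leo_anti).
    - by apply: sort_sorted => i j; apply: leq_total.
    - by rewrite -sorted_map.
    - by apply/allP => e _ /=; rewrite count_s.
  have size_f : size (seq_of_mult f) = k by rewrite -size_s st size_tuple.
  rewrite size_f eqxx -sum_s st sum_t eqxx; split=> //.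
  by apply/eqP/val_inj; rewrite /= PE.
rewrite !inE /= => /andP[/eqP size_f /eqP sum_f]; rewrite PE // sum_s sum_f eqxx andbT.
apply/andP; split; last first.
  by rewrite sorted_map; apply: sort_sorted => i j; apply: leq_total.
by rewrite all_map all_sort all_map; apply/allP => x _ /=.
Qed.

End Multisets.

(** By injectivity the blocks of equal values of [g] are the blocks of equal entries of [t]; an [e]
    absent from [t] contributes the factor 1. *)
Lemma otimes_map (I : finType) (g : I -> nat) (t : seq I) : injective g ->
  otimes (map g t) = \prod_e 'C((g e + count_mem e t).-1, count_mem e t).
Proof.
move=> g_inj; rewrite /otimes undup_map_inj // big_map.
rewrite big_uniq ?undup_uniq //= [RHS](bigID (mem t)) /= [X in (_ * X)%N]big1 => [|e nte].
  rewrite muln1; apply: eq_big => e; first by rewrite mem_undup.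
  move=> _; rewrite count_map (@eq_count _ _ (pred1 e)) // => e'.
  exact: (inj_eq g_inj).
by rewrite (count_memPn nte) bin0.
Qed.

Local Open Scope ring_scope.

(** * Factorization in F[x, y] *)

Definition divides (R : pzRingType) (a b : R) : Prop := exists c, b = c * a.

Definition prime_elt (R : unitRingType) (p : R) : Prop :=
  [/\ p != 0, p \isn't a GRing.unit &
      forall a b : R, divides p (a * b) -> divides p a \/ divides p b].

(** Required of all nonzero elements, this is factoriality. Prime factors, unlike merely irreducible
    ones, can be cancelled directly from one side of a product. *)
Definition prime_factored (R : unitRingType) (c : R) : Prop :=
  exists u (s : seq R), [/\ u \is a GRing.unit, {in s, forall p, prime_elt p}
    & c = u * \prod_(p <- s) p].

Section Divides.
Variable R : comPzRingType.
Implicit Types a b c : R.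

Lemma dividesMl c a b : divides a b -> divides a (c * b).
Proof. by case=> d ->; exists (c * d); rewrite mulrA. Qed.

Lemma dividesMr c a b : divides a b -> divides a (b * c).
Proof. by rewrite mulrC; apply: dividesMl. Qed.

Lemma dividesD a b c : divides a b -> divides a c -> divides a (b + c).
Proof. by move=> [d ->] [e ->]; exists (d + e); rewrite mulrDl. Qed.

Lemma divides_sum I (r : seq I) (P : pred I) (F : I -> R) a :
  (forall i, P i -> divides a (F i)) -> divides a (\sum_(i <- r | P i) F i).
Proof.
move=> dvF; elim/big_rec: _ => [|i x Pi]; first by exists 0; rewrite mul0r.
by apply: dividesD; apply: dvF.
Qed.

Lemma dividesB a b c : divides a (b + c) -> divides a c -> divides a b.
Proof. by move=> [d dE] [e eE]; exists (d - e); rewrite mulrBl -dE -eE addrK. Qed.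

End Divides.

Lemma divides_polyC (R : comNzRingType) (a : R) (f : {poly R}) :
  divides a%:P f <-> forall i, divides a f`_i.
Proof.
split=> [[g ->] i|dvf]; first by exists g`_i; rewrite coefMC.
have [g gE] := choice dvf.
exists (\poly_(i < size f) g i); apply/polyP => i; rewrite coefMC coef_poly.
by case: ltnP => [_|lefi]; rewrite -?gE // mul0r nth_default.
Qed.

(** * Gauss's lemma for polynomials over a factorial domain *)

Section GaussLemma.
Variable R : idomainType.
Implicit Types (a c q : R) (f g h : {poly R}).

(** If [q] divides neither [f] nor [g], let [i] and [j] be the least indices of coefficients that it
    does not divide. In the coefficient [i + j] of the product every term but one is divisible by
    [q], so [q] divides that term too, against primality. *)
Lemma prime_polyC q : prime_elt q -> prime_elt q%:P.
Proof.
move=> [q_neq0 q_nunit q_prime]; split; first by rewrite polyC_eq0.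
  by rewrite poly_unitE size_polyC coefC eqxx q_neq0.
have exmin h : ~ divides q%:P h ->
    exists2 i, ~ divides q h`_i & forall j, (j < i)%N -> divides q h`_j.
  move=> ndh; have exP : exists i, `[< ~ divides q h`_i >].
    apply: contrapT => nex; apply/ndh/divides_polyC => i.
    by apply: contrapT => ndi; apply: nex; exists i; apply/asboolP.
  case: (ex_minnP exP) => i /asboolP ndi imin; exists i => // j ltji.
  apply: contrapT => ndj; have := imin j (asboolT ndj).
  by rewrite leqNgt ltji.
move=> f g /divides_polyC dvfg.
case: (pselect (divides q%:P f)) => [|/exmin[i ndi imin]]; first by left.
case: (pselect (divides q%:P g)) => [|/exmin[j ndj jmin]]; first by right.
suff /q_prime[] : divides q (f`_i * g`_j) by [].
have lti : (i < (i + j).+1)%N by rewrite ltnS leq_addr.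
have := dvfg (i + j)%N; rewrite coefM (bigD1 (Ordinal lti)) //= addKn.
move=> /dividesB; apply; apply: divides_sum => l; rewrite -val_eqE /= => neq_li.
case: (ltngtP l i) neq_li => // [/imin ?|ltil] _; first exact: dividesMr.
apply/dividesMl/jmin; rewrite ltn_subLR ?ltn_add2r //.
by rewrite -ltnS.
Qed.

Lemma irreducible_not_dividesC q f :
  prime_elt q -> irreducible_elt f -> (1 < size f)%N -> ~ divides q%:P f.
Proof.
move=> [_ q_nunit _] [_ _ f_irr] size_f [g fE]; case: (f_irr _ _ fE) => [g_unit|].
  move: size_f g_unit; rewrite fE mulrC mul_polyC poly_unitE => size_g /andP[/eqP g1 _].
  by have := leq_trans size_g (size_scale_leq _ _); rewrite g1.
by rewrite poly_unitE coefC eqxx (negPf q_nunit) andbF.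
Qed.

Lemma polyC_unit c : (c%:P \is a GRing.unit) = (c \is a GRing.unit).
Proof.
rewrite poly_unitE coefC eqxx size_polyC.
by have [->|] := eqVneq c 0; rewrite ?unitr0 ?andbF.
Qed.

(* [c] plays the part of a common denominator in Frac(R)[X]: its prime factors are
   cancelled one at a time. *)
Lemma irreducible_divides_scale f g c :
  irreducible_elt f -> (1 < size f)%N -> prime_factored c ->
  divides f (c *: g) -> divides f g.
Proof.
move=> f_irr size_f [u [s [u_unit]]]; elim: s c g => [|q s IHs] c g s_prime ->.
  rewrite big_nil mulr1 => -[h ugE]; exists (u^-1 *: h).
  by rewrite -scalerAl -ugE scalerA mulVr ?scale1r.
have q_prime : prime_elt q by apply: s_prime; rewrite mem_head.
have {}s_prime : {in s, forall p, prime_elt p}.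
  by move=> p ps; apply: s_prime; rewrite inE ps orbT.
rewrite big_cons mulrCA -scalerA -[q *: _]mul_polyC => -[h qE].
have [_ _ /(_ h f)[||]] := prime_polyC q_prime.
- by exists ((u * \prod_(p <- s) p) *: g); rewrite -qE mulrC.
- move=> [h' hE]; apply: IHs s_prime (erefl _) _; exists h'.
  have [q_neq0 _ _] := q_prime; apply: (mulfI (_ : q%:P != 0)).
    by rewrite polyC_eq0.
  by rewrite qE hE mulrAC mulrC.
- by move/(irreducible_not_dividesC q_prime f_irr size_f).
Qed.

(** This is irreducibility of [f] over the fraction field. Each prime factor of [c] divides [g] or
    [h], and cancelling it there leaves both sizes unchanged. *)
Lemma irreducible_scale_factor f g h c :
  irreducible_elt f -> (1 < size f)%N -> prime_factored c ->
  c *: f = g * h -> size g = 1%N \/ size h = 1%N.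
Proof.
move=> f_irr size_f [u [s [u_unit]]]; elim: s c g h => [|q s IHs] c g h s_prime ->.
  rewrite big_nil mulr1 => ufE.
  have [_ _ /(_ (u^-1 *: g) h)[||]] := f_irr.
  - by rewrite -scalerAl -ufE scalerA mulVr ?scale1r.
  - rewrite poly_unitE size_scale.
      by move=> /andP[/eqP]; left.
    by apply: contraTneq u_unit => u0; rewrite -unitrV u0 unitr0.
  - by rewrite poly_unitE => /andP[/eqP]; right.
have q_prime : prime_elt q by apply: s_prime; rewrite mem_head.
have {}s_prime : {in s, forall p, prime_elt p}.
  by move=> p ps; apply: s_prime; rewrite inE ps orbT.
have [q_neq0 _ _] := q_prime.
rewrite big_cons mulrCA -scalerA -[q *: _]mul_polyC => qE.
have [_ _ /(_ g h)[||]] := prime_polyC q_prime.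
- by exists ((u * \prod_(p <- s) p) *: f); rewrite -qE mulrC.
- move=> [g' gE]; rewrite gE mulrC mul_polyC size_scale //.
  apply: IHs s_prime (erefl _) _; apply: (mulfI (_ : q%:P != 0)).
    by rewrite polyC_eq0.
  by rewrite qE gE mulrAC mulrC.
- move=> [h' hE]; rewrite hE [h' * _]mulrC mul_polyC size_scale //.
  apply: IHs s_prime (erefl _) _; apply: (mulfI (_ : q%:P != 0)).
    by rewrite polyC_eq0.
  by rewrite qE hE mulrA mulrC.
Qed.

Hypothesis R_factorial : forall c, c != 0 -> prime_factored c.

(** Euclid's argument over the fraction field: either [f] is coprime to [g] and divides [h], or
    their gcd is associated to [f] and [f] divides [g]. *)
Lemma irreducible_prime_poly f : irreducible_elt f -> (1 < size f)%N -> prime_elt f.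
Proof.
move=> f_irr size_f; have [f_neq0 f_nunit _] := f_irr; split=> // g h f_dvd.
(* [%|] is pseudo-divisibility, i.e. divisibility over Frac(R). *)
have pdvd k : f %| k -> divides f k.
  case/Pdiv.WeakIdomain.dvdpP => -[c q] /= c_neq0 cqE.
  by apply: (irreducible_divides_scale f_irr size_f (R_factorial c_neq0)); exists q.
have f_dvdp : f %| g * h.
  case: f_dvd => q ->; apply: dvdp_mull; exact: dvdpp.
case: (boolP (coprimep f g)) => [cop|ncop].
  by right; apply: pdvd; rewrite -(Gauss_dvdpr _ cop).
left; apply: pdvd; apply: dvdp_trans (dvdp_gcdr f g).
(* In [c *: f = q * gcdp f g] the gcd is not constant, so the cofactor [q] is. *)
have /Pdiv.WeakIdomain.dvdpP[[c q] /= c_neq0 cqE] := dvdp_gcdl f g.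
have [size_q|] :=
    irreducible_scale_factor f_irr size_f (R_factorial c_neq0) cqE; last first.
  by move/eqP; rewrite -coprimep_def (negPf ncop).
have /size_poly1P[d d_neq0 qE] : size q == 1%N by rewrite size_q.
rewrite -(dvdpZl _ _ c_neq0) cqE qE mul_polyC.
by rewrite dvdpZl ?dvdpp.
Qed.

Lemma irreducible_polyC c : irreducible_elt c%:P -> irreducible_elt c.
Proof.
move=> [c_neq0 c_nunit c_irr]; split; first by rewrite -polyC_eq0.
  by rewrite -polyC_unit.
by move=> a b cE; rewrite -!polyC_unit; apply: c_irr; rewrite cE polyCM.
Qed.

(** Splitting one prime [q] off the factorization leaves a unit cofactor by irreducibility, so [c]
    is associated to [q]. *)
Lemma prime_factored_irreducible c : prime_factored c -> irreducible_elt c -> prime_elt c.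
Proof.
move=> [u [s [u_unit s_prime cE]]] [c_neq0 c_nunit c_irr]; split=> // a b.
case: s s_prime cE => [|q s] s_prime cE.
  by case/negP: c_nunit; rewrite cE big_nil mulr1.
have [q_neq0 q_nunit q_prime] : prime_elt q by apply: s_prime; rewrite mem_head.
have {}cE : c = u * (\prod_(p <- s) p) * q by rewrite cE big_cons mulrA mulrAC.
have [v_unit|/(negP q_nunit)//] := c_irr _ _ cE.
have cq d : divides c d <-> divides q d.
  split=> -[e ->]; rewrite cE.
    by exists (e * (u * \prod_(p <- s) p)); rewrite mulrA.
  by exists (e / (u * \prod_(p <- s) p)); rewrite mulrA divrK.
by rewrite !cq; apply: q_prime.
Qed.

Theorem irreducible_prime_factorial_poly f : irreducible_elt f -> prime_elt f.
Proof.
move=> f_irr; have [size_f|/size1_polyC fE] := ltnP 1 (size f).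
  exact: irreducible_prime_poly.
move: (f`_0) fE f_irr => c -> /irreducible_polyC c_irr; apply: prime_polyC.
by apply: prime_factored_irreducible (c_irr); apply/R_factorial; case: c_irr.
Qed.

End GaussLemma.

(** By induction on the size: a polynomial that is neither a unit nor prime has two factors of
    smaller size. *)
Lemma field_poly_factorial (F : fieldType) (f : {poly F}) : f != 0 -> prime_factored f.
Proof.
elim/ltn_ind: {f}(size f) {-2}f (erefl (size f)) => n IHn f size_f f_neq0.
have [f_unit|f_nunit] := boolP (f \is a GRing.unit).
  by exists f, [::]; rewrite big_nil mulr1.
case: (pselect (prime_elt f)) => [f_prime|nf_prime].
  exists 1, [:: f]; rewrite unitr1 mul1r big_seq1; split=> // p.
  by rewrite inE => /eqP->.
(* Without such a splitting [f] would be prime: its gcd with [a] is either trivial or has a constant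
   cofactor in [f], and then [f] divides [a]. *)
have [g [h [fE size_g size_h]]] :
    exists g h, [/\ f = g * h, (size g < n)%N & (size h < n)%N].
  apply: contrapT => nex; apply: nf_prime; split=> // a b [q abE].
  have [cop|ncop] := boolP (coprimep f a).
    by right; apply/dvdpP; rewrite -(Gauss_dvdpr _ cop) abE dvdp_mull.
  left; apply/dvdpP; apply: dvdp_trans (dvdp_gcdr f a).
  have /dvdpP[r fE] := dvdp_gcdl f a.
  have /andP[r_neq0 g_neq0] : (r != 0) && (gcdp f a != 0).
    by rewrite -negb_or -mulf_eq0 -fE.
  have := size_mul r_neq0 g_neq0; rewrite -fE size_f => nE.
  have size_r : size r == 1%N.
    apply: contraT => r_neq1; case: nex; exists r, (gcdp f a); split=> //.
    - move: ncop; rewrite coprimep_def nE -subn1 ltn_subRL.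
      have := g_neq0; rewrite -size_poly_eq0; case: (size _) => [|[]] // m _ _.
      by rewrite addnC ltn_add2l.
    - move: r_neq1; rewrite nE -subn1 ltn_subRL.
      have := r_neq0; rewrite -size_poly_eq0; case: (size r) => [|[]] // m _ _.
      by rewrite ltn_add2r.
  have /size_poly1P[d d_neq0 rE] := size_r.
  by rewrite {1}fE rE mul_polyC dvdpZl.
have /andP[g_neq0 h_neq0] : (g != 0) && (h != 0) by rewrite -negb_or -mulf_eq0 -fE.
have [u [s [u_unit s_prime gE]]] := IHn _ size_g g (erefl _) g_neq0.
have [v [t [v_unit t_prime hE]]] := IHn _ size_h h (erefl _) h_neq0.
exists (u * v), (s ++ t); split; first by rewrite unitrM u_unit.
  by move=> p; rewrite mem_cat => /orP[/s_prime|/t_prime].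
by rewrite fE gE hE big_cat /= mulrACA.
Qed.

(** * Uniqueness of prime factorizations *)

Section UniqueFactorization.
Variable R : idomainType.

Lemma prime_divides_prod (p : R) (s : seq R) : prime_elt p ->
  divides p (\prod_(q <- s) q) -> exists2 q, q \in s & divides p q.
Proof.
move=> [_ p_nunit p_prime]; elim: s => [|q s IHs].
  rewrite big_nil => -[c cpE]; case/negP: p_nunit.
  by apply/unitrPr; exists c; rewrite mulrC.
rewrite big_cons => /p_prime[dv_q|/IHs[r r_s dv_r]]; first by exists q; rewrite ?mem_head.
by exists r; rewrite // inE r_s orbT.
Qed.

(** The head of [s] divides some element of [t], hence equals it and can be cancelled. The second
    hypothesis chooses one representative among associates, so no units appear. *)
Lemma prime_factorization_unique (s t : seq R) :
  {in s ++ t, forall p, prime_elt p} -> {in s & t, forall p q, divides p q -> p = q} ->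
  \prod_(p <- s) p = \prod_(p <- t) p -> perm_eq s t.
Proof.
elim: s t => [|p s IHs] t st_prime st_eq.
  rewrite big_nil; case: t st_prime {st_eq} => // q t t_prime; rewrite big_cons => qE.
  have [_ /negP[]] := t_prime q (mem_head _ _).
  by apply/unitrPr; exists (\prod_(p <- t) p).
have p_prime : prime_elt p by apply: st_prime; rewrite mem_head.
have [p_neq0 _ _] := p_prime.
rewrite big_cons => stE; have [|q q_t p_q] := @prime_divides_prod p t p_prime.
  by rewrite -stE mulrC; exists (\prod_(p <- s) p).
have pqE : p = q by apply: st_eq => //; rewrite mem_head.
rewrite -pqE in q_t.
rewrite perm_sym (perm_trans (perm_to_rem q_t)) // perm_cons perm_sym.
apply: IHs => [r|r r' r_s r_t|].
- rewrite mem_cat => r_st; apply: st_prime; rewrite mem_cat inE.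
  by case/orP: r_st => [->|/mem_rem ->]; rewrite ?orbT.
- by apply: st_eq; rewrite ?inE ?r_s ?orbT // (mem_rem r_t).
by apply: (mulfI p_neq0); rewrite stE (perm_big _ (perm_to_rem q_t)) big_cons.
Qed.

End UniqueFactorization.

(** * Transport of divisibility along ring isomorphisms *)

Section BijectiveMorphism.
Variables (R S : idomainType) (f : {rmorphism R -> S}) (g : S -> R).
Hypotheses (fK : cancel f g) (gK : cancel g f).

Lemma bij_rmorph_unit x : (f x \is a GRing.unit) = (x \is a GRing.unit).
Proof.
apply/idP/idP => [fx_unit|]; last exact: rmorph_unit.
apply/unitrPr; exists (g (f x)^-1); apply: (can_inj fK).
by rewrite rmorphM gK rmorph1 divrr.
Qed.

Lemma bij_rmorph_irreducible x : irreducible_elt x -> irreducible_elt (f x).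
Proof.
move=> [x_neq0 x_nunit x_irr]; split.
- by rewrite -(rmorph0 f) (can_eq fK).
- by rewrite bij_rmorph_unit.
move=> a b fxE; rewrite -[a]gK -[b]gK !bij_rmorph_unit; apply: x_irr.
by apply: (can_inj fK); rewrite rmorphM !gK.
Qed.

Lemma bij_rmorph_divides x y : divides (f x) (f y) <-> divides x y.
Proof.
split=> -[c]; last by move=> ->; exists (f c); rewrite rmorphM.
by rewrite -[c]gK -rmorphM => /(can_inj fK) ->; exists (g c).
Qed.

Lemma bij_rmorph_prime x : prime_elt (f x) -> prime_elt x.
Proof.
move=> [fx_neq0 fx_nunit fx_prime]; split.
- by apply: contraNneq fx_neq0 => ->; rewrite rmorph0.
- by rewrite -bij_rmorph_unit.
by move=> a b; rewrite -!bij_rmorph_divides rmorphM; apply: fx_prime.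
Qed.

End BijectiveMorphism.

Notation mnm2 i j := [multinom [tuple i; j]].

Lemma mnm2E (m : 'X_{1..2}) i j :
  (m == mnm2 i j) = (m ord0 == i) && (m ord_max == j).
Proof.
apply/eqP/andP => [->|[/eqP <- /eqP <-]]; first by rewrite !multinomE.
apply/mnmP => k; rewrite multinomE.
case: k => -[|[|//]] ltk; rewrite (tnth_nth 0%N) /=; congr (m _); exact: val_inj.
Qed.

Lemma mdeg2 (m : 'X_{1..2}) : mdeg m = (m ord0 + m ord_max)%N.
Proof.
rewrite mdegE !big_ord_recl big_ord0 addn0.
by congr (_ + m _)%N; apply: val_inj.
Qed.

Lemma mdeg_mnm2 i j : mdeg (mnm2 i j) = (i + j)%N.
Proof. by rewrite mdeg2 !multinomE. Qed.

Lemma mnm2_eta (m : 'X_{1..2}) : m = mnm2 (m ord0) (m ord_max).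
Proof. by apply/eqP; rewrite mnm2E !eqxx. Qed.

(** * F[x, y] as an iterated polynomial ring, and top forms *)

Section PolyPoly.
Variable F : fieldType.
Implicit Types p q : {mpoly F[2]}.

(** The isomorphism of F[x, y] with F[x][y]: x becomes the inner variable and y the outer one. *)
Definition poly2_of_mpoly : {mpoly F[2]} -> {poly {poly F}} :=
  mmap (polyC \o polyC) (fun i : 'I_2 => if i == ord0 then 'X%:P else 'X).

(* The substitution x := t * s, y := s, where s is the outer and t the inner
   variable: the coefficient of s^j is the form of degree j evaluated at (t, 1). *)
Definition top_poly2 : {mpoly F[2]} -> {poly {poly F}} :=
  mmap (polyC \o polyC) (fun i : 'I_2 => if i == ord0 then 'X%:P * 'X else 'X).

HB.instance Definition _ := GRing.RMorphism.on poly2_of_mpoly.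
HB.instance Definition _ := GRing.RMorphism.on top_poly2.

Lemma mmap1_2 (S : comNzRingType) (a b : S) (m : 'X_{1..2}) :
  mmap1 (fun i : 'I_2 => if i == ord0 then a else b) m = a ^+ m ord0 * b ^+ m ord_max.
Proof.
rewrite /mmap1 !big_ord_recl big_ord0 mulr1 /=.
by congr (_ * _ ^+ m _); apply: val_inj.
Qed.

Lemma sum_mcoeff_eq p n (m : 'X_{1..2}) : (msize p <= n)%N ->
  \sum_(m' : 'X_{1..2 < n}) p@_m' * (m == m')%:R = p@_m.
Proof.
move=> le_pn; rewrite {2}(mpolywE le_pn) raddf_sum /=; apply: eq_bigr => m' _.
by rewrite mcoeffZ mcoeffX eq_sym.
Qed.

Lemma coef_poly2_of_mpoly p i j : (poly2_of_mpoly p)`_j`_i = p@_(mnm2 i j).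
Proof.
rewrite /poly2_of_mpoly (mmapE (msize p)) // !coef_sum.
rewrite -(sum_mcoeff_eq _ (leqnn (msize p))); apply: eq_bigr => m _.
rewrite mmap1_2 /= -polyC_exp mulrA -polyCM coefCM coefXn mulr_natr.
rewrite coefMn coefCM coefXn -mulrnAr -mulrnA mulnb.
by rewrite [mnm2 _ _ == _]eq_sym mnm2E ![m _ == _]eq_sym.
Qed.

(** The monomial x^a y^b is sent to t^a s^(a+b), so t^i s^j comes only from a = i and b = j - i. *)
Lemma coef_top_poly2 p i j :
  (top_poly2 p)`_j`_i = if (i <= j)%N then p@_(mnm2 i (j - i)%N) else 0.
Proof.
rewrite /top_poly2 (mmapE (msize p)) // !coef_sum.
have -> : (if (i <= j)%N then p@_(mnm2 i (j - i)%N) else 0) =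
    \sum_(m : 'X_{1..2 < msize p}) p@_m * ((i <= j)%N && (mnm2 i (j - i)%N == m))%:R.
  case: leqP => _; first by rewrite sum_mcoeff_eq.
  by rewrite big1 // => m _; rewrite mulr0.
apply: eq_bigr => m _.
rewrite mmap1_2 /= exprMn -polyC_exp -mulrA -exprD mulrA -polyCM coefCM coefXn mulr_natr.
rewrite coefMn coefCM coefXn -mulrnAr -mulrnA mulnb; congr (_ * (nat_of_bool _)%:R).
rewrite [mnm2 _ _ == _]eq_sym mnm2E ![m _ == _]eq_sym.
have [->|_] := eqVneq i (m ord0); rewrite ?andbF //=.
have [le_j|lt_j] := leqP (m ord0) j; first by rewrite -{1}(subnKC le_j) eqn_add2l.
by rewrite ltn_eqF // ltn_addr.
Qed.

Lemma poly2_of_mpoly_inj : injective poly2_of_mpoly.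
Proof.
move=> p q eq_pq; apply/mpolyP => m.
by rewrite [m]mnm2_eta -!coef_poly2_of_mpoly eq_pq.
Qed.

Lemma poly2_of_mpoly_bij : bijective poly2_of_mpoly.
Proof.
pose g (f : {poly {poly F}}) : {mpoly F[2]} :=
  \sum_(j < size f) \sum_(i < size f`_j) f`_j`_i *: 'X_[mnm2 (val i) (val j)].
suff gK : cancel g poly2_of_mpoly.
  by exists g => //; apply: inj_can_sym poly2_of_mpoly_inj.
move=> f; rewrite /g rmorph_sum -[RHS]coefK poly_def; apply: eq_bigr => j _.
rewrite rmorph_sum /= -mul_polyC -[f`_j in RHS]coefK poly_def rmorph_sum mulr_suml.
apply: eq_bigr => i _.
rewrite /= {1}/poly2_of_mpoly mmapZ mmapX mmap1_2 !multinomE /=.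
by rewrite -mul_polyC polyCM polyC_exp mulrA.
Qed.

(** F[x] is factorial, so Gauss's lemma applies to F[x][y] and transfers through the isomorphism. *)
Theorem irreducible_prime_mpoly2 p : irreducible_elt p -> prime_elt p.
Proof.
have [g fK gK] := poly2_of_mpoly_bij => p_irr.
apply: (bij_rmorph_prime fK gK); apply: irreducible_prime_factorial_poly.
  exact: field_poly_factorial.
exact: (bij_rmorph_irreducible fK gK).
Qed.

(** The outer degree is the total degree: the leading monomial of [p] has maximal total degree and
    its coefficient survives. *)
Lemma size_top_poly2 p : size (top_poly2 p) = msize p.
Proof.
apply/eqP; rewrite eqn_leq; apply/andP; split.
  apply/leq_sizeP => j le_pj; apply/polyP => i; rewrite coef_top_poly2 coef0.
  case: leqP => // le_ij; apply/memN_msupp_eq0/msize_mdeg_ge.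
  by rewrite mdeg_mnm2 subnKC.
have [->|p_neq0] := eqVneq p 0; first by rewrite msize0.
rewrite -(mlead_deg p_neq0) ltnNge; apply/negP => /leq_sizeP/(_ _ (leqnn _)).
move/(congr1 (fun f : {poly F} => f`_(mlead p ord0))).
rewrite coef_top_poly2 coef0 mdeg2 leq_addr addKn -mnm2_eta => /eqP.
by rewrite mleadc_eq0 (negPf p_neq0).
Qed.

Lemma size_coef_top_poly2 p j : (size ((top_poly2 p)`_j)%R <= j.+1)%N.
Proof. by apply/leq_sizeP => i ltji; rewrite coef_top_poly2 leqNgt ltji. Qed.

Lemma mpoly_unitE (p : {mpoly F[2]}) : (p \is a GRing.unit) = (msize p == 1%N).
Proof.
apply/idP/msize_poly1P => [/andP[/eqP pE]|[c c_neq0 ->]].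
  by rewrite unitfE => p0; exists p@_0.
by rewrite rmorph_unit ?unitfE.
Qed.

(* Comparing leading coefficients in the grading by total degree: the top form
   of a factor of [p] divides that of [p], so one of the factors has a constant
   dehomogenized top form, and then the other one already has full degree. *)
Lemma irreducible_top_form p d :
  msize p = d.+1 -> (0 < d)%N -> irreducible_poly ((top_poly2 p)`_d) ->
  size ((top_poly2 p)`_d) = d.+1 -> irreducible_elt p.
Proof.
move=> size_p d_gt0 [_ top_irr] size_top; split.
- by rewrite -msize_poly_eq0 size_p.
- by rewrite mpoly_unitE size_p; case: d d_gt0 {size_p top_irr size_top}.
have topE : (top_poly2 p)`_d = lead_coef (top_poly2 p).
  by rewrite lead_coefE size_top_poly2 size_p.
move: top_irr size_top; rewrite topE => top_irr size_top a b pE.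
have const_top_unit x y : p = x * y ->
    size (lead_coef (top_poly2 x)) = 1%N -> x \is a GRing.unit.
  move=> xyE size_x; have : x * y != 0 by rewrite -xyE -msize_poly_eq0 size_p.
  rewrite mulf_eq0 => /norP[x_neq0 y_neq0].
  have lx_neq0 : lead_coef (top_poly2 x) != 0 by rewrite -size_poly_eq0 size_x.
  have : lead_coef (top_poly2 y) != 0.
    by rewrite lead_coef_eq0 -size_poly_eq0 size_top_poly2 msize_poly_eq0.
  move/(size_mul lx_neq0); rewrite -lead_coefM -rmorphM -xyE size_top size_x add1n /=.
  rewrite lead_coefE => size_y.
  (* The coefficient of s^j has degree at most j in t, so [y] has degree at least [d], which leaves
     degree 0 for [x]. *)
  have := size_coef_top_poly2 y (size (top_poly2 y)).-1.
  rewrite -size_y size_top_poly2; have := msizeM x_neq0 y_neq0; rewrite -xyE size_p.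
  rewrite mpoly_unitE; move: x_neq0 y_neq0; rewrite -!msize_poly_eq0.
  case: (msize x) (msize y) => [|m] [|n] //= _ _; rewrite addnS eqSS => -[->].
  by rewrite ltnS -[leqRHS]add0n leq_add2r leqn0.
have := pE; rewrite mulrC => pE'.
have [size_a|size_a] := eqVneq (size (lead_coef (top_poly2 a))) 1%N.
  by left; apply: const_top_unit pE size_a.
right; apply: const_top_unit pE' _.
have lead_pE : lead_coef (top_poly2 p) =
    lead_coef (top_poly2 a) * lead_coef (top_poly2 b).
  by rewrite -lead_coefM -rmorphM -pE.
have : lead_coef (top_poly2 a) %= lead_coef (top_poly2 p).
  by apply: top_irr => //; rewrite lead_pE dvdp_mulIl.
move/eqp_size; rewrite size_top => size_la.
have : lead_coef (top_poly2 p) != 0 by rewrite -size_poly_eq0 size_top.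
rewrite lead_pE mulf_eq0 => /norP[la lb].
have := size_mul la lb; rewrite -lead_pE size_top size_la addSn /= -addn1.
by move/addnI.
Qed.

End PolyPoly.

(** * Strict growth of the number of irreducible polynomials *)

(** [L] is the splitting field of X^(|F|^m) - X. The roots are distinct and form a subfield, hence
    all of [L], which therefore has |F|^m elements. *)
Lemma finField_ext_dim (F : finFieldType) (m : nat) : (0 < m)%N ->
  exists L : splittingFieldType F, \dim {:L} = m.
Proof.
move=> m_gt0; pose q (K : nzRingType) : {poly K} := 'X^(#|F| ^ m) - 'X.
have qm_gt1 : (1 < #|F| ^ m)%N.
  by rewrite -[1%N](expn0 #|F|) ltn_exp2l // finNzRing_gt1.
have size_q (K : nzRingType) : size (q K) = (#|F| ^ m).+1.
  by rewrite size_polyDl ?size_polyXn // size_polyN size_polyX.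
have /FinSplittingFieldFor[L] : q F != 0 by rewrite -size_poly_gt0 size_q.
rewrite rmorphB rmorphXn /= map_polyX -/(q L) => -[zs DqL defL]; exists L.
have [p p_pr pcharF] := finPcharP F.
have pcharL : p \in [pchar L] by rewrite pchar_lalg.
have qE : #|F|%:R = 0 :> L.
  have [e ->] : exists e, #|F| = (p ^ e.+1)%N.
    have := card_pprimeChar pcharF; case: (logn _ _) => [|e ->]; last by exists e.
    by move=> F1; have := finNzRing_gt1 F; rewrite F1.
  by rewrite natrX pcharf0 // expr0n.
(* The derivative is -1, because |F| vanishes in [L]. *)
have Uzs : uniq zs.
  rewrite -separable_prod_XsubC -(eqp_separable DqL) unlock.
  rewrite derivB derivX derivXn -mulr_natl natrX.
  rewrite -(prednK m_gt0) exprS -polyC_natr qE polyC0 !mul0r sub0r.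
  by rewrite coprimep_sym -scaleN1r coprimepZl ?coprime1p // oppr_eq0 oner_eq0.
have [a _ Da] := finField_galois_generator (sub1v {:L}%AS).
rewrite /= dimv1 expn1 in Da.
(* With [a] the Frobenius map z -> z^|F|, the roots are the fixed points of its [m]-th power. *)
pose E := fixedSpace (a ^+ m)%g.
have in_zs : zs =i E.
  move=> z; rewrite -root_prod_XsubC -(eqp_root DqL) (sameP fixedSpaceP eqP).
  rewrite /root !hornerE subr_eq0 /=; congr (_ == z).
  elim: (m) => [|i IHi]; first by rewrite gal_id.
  by rewrite expgSr expnSr exprM IHi galM ?Da ?memvf.
have defE : E = {:L}%VS.
  apply/eqP; rewrite eqEsubv subvf -defL -[E]subfield_closed agenvS //.
  by rewrite subv_add sub1v; apply/span_subvP => z; rewrite in_zs.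
pose Lf := FinFieldExtType L.
have cardL : #|Lf| = (#|F| ^ m)%N.
  have /eq_card-> : Lf =i zs by move=> z; rewrite in_zs defE memvf.
  apply: succn_inj; rewrite (card_uniqP _) //= -(size_prod_XsubC _ id).
  by rewrite -(eqp_size DqL) size_q.
apply/eqP; rewrite -(eqn_exp2l _ _ (finNzRing_gt1 F)) -cardL.
by rewrite -(@card_vspace F Lf _ {:L}%VS); apply/eqP/eq_card => z; rewrite memvf.
Qed.

(** The minimal polynomial of a primitive element of the extension of degree [m], which is
    separable. *)
Lemma irreducible_poly_of_degree (F : finFieldType) (m : nat) : (0 < m)%N ->
  exists2 f : {poly F}, irreducible_poly f & size f = m.+1.
Proof.
move=> m_gt0; have [L dimL] := finField_ext_dim F m_gt0.
have sep1L : separable 1 {:L} by have /and3P[] := finField_galois (sub1v {:L}%AS).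
pose z := separable_generator 1 {:L}.
have defL : <<1; z>>%VS = {:L}%VS.
  apply/eqP; rewrite eqEsubv subvf.
  exact: (sub_adjoin_separable_generator sep1L).
have /polyOver1P[f Df] := minPolyOver 1 z.
have size_f : size f = m.+1.
  rewrite -(size_map_poly (in_alg L)) -Df size_minPoly adjoin_degreeE defL.
  by rewrite dimv1 divn1 dimL.
exists f => //; split=> [|g g_neq1 g_dvd]; first by rewrite size_f.
have Kg : map_poly (in_alg L) g \is a polyOver 1%VS by apply: alg_polyOver.
have := @minPoly_irr _ _ _ z _ Kg; rewrite Df dvdp_map => /(_ g_dvd).
rewrite eqp_map -(rmorph1 (map_poly (in_alg L))) eqp_map -size_poly_eq1.
by rewrite (negPf g_neq1) orbF.
Qed.

(** * Normalization as a leading coefficient, and injectivity of I *)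

Section Normalized.
Variable F : finFieldType.
Implicit Types p q : {mpoly F[2]}.

Lemma head_filter_mkseq (T : Type) (x0 : T) (P : pred T) (f : nat -> T) n i :
  (i < n)%N -> P (f i) -> (forall j, (j < i)%N -> ~~ P (f j)) ->
  head x0 [seq x <- mkseq f n | P x] = f i.
Proof.
move=> lt_in Pfi nPf; rewrite /mkseq -(subnKC (ltnW lt_in)) iotaD map_cat filter_cat.
rewrite (_ : [seq x <- map f (iota 0 i) | P x] = [::]) /=.
  by move: lt_in; rewrite add0n -subn_gt0; case: (n - i)%N => //= m _; rewrite Pfi.
rewrite filter_map (_ : filter _ _ = [::]) //.
apply/eqP; rewrite -[_ == _]negbK -has_filter -all_predC.
by apply/allP => j; rewrite mem_iota; apply: nPf.
Qed.

(** Among monomials of degree [d] the monomial order is x^d > x^(d-1) y > ... > y^d, so the first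
    nonzero top coefficient is the leading one. *)
Lemma normalized_mleadc d p : has_degree d p -> normalized d p <-> mleadc p = 1.
Proof.
move=> size_p; have p_neq0 : p != 0 by rewrite -msize_poly_eq0 size_p.
have := mlead_deg p_neq0; rewrite size_p => -[].
set m := mlead p; rewrite mdeg2 => dE.
suff -> : normalized d p = (p@_m = 1) by [].
have mE : m = mnm2 (d - m ord_max)%N (m ord_max) by rewrite -dE addnK -mnm2_eta.
rewrite /normalized; congr (_ = _).
rewrite (@head_filter_mkseq _ _ _ _ _ (m ord_max)) -?mE //.
- by rewrite ltnS -dE leq_addl.
- by rewrite mleadc_eq0.
move=> j lt_j; rewrite negbK; apply/eqP/mcoeff_gt_mlead.
have le_jd : (j <= d)%N by rewrite -dE ltnW // ltn_addl.
rewrite -/m [m]mE; apply/ltmcP.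
  by rewrite !mdeg_mnm2 !subnK // -dE leq_addl.
exists ord0 => [[]|] //; rewrite !multinomE !(tnth_nth 0%N) /=.
by rewrite ltn_sub2l // -dE; apply: leq_trans lt_j _; rewrite leq_addl.
Qed.

Lemma finite_msize_le d : finite_set [set p : {mpoly F[2]} | (msize p <= d)%N]%classic.
Proof.
pose g (c : {ffun 'X_{1..2 < d} -> F}) : {mpoly F[2]} := \sum_m c m *: 'X_[m].
apply: (@sub_finite_set _ _ (g @` setT)%classic); last first.
  by apply: finite_image; exact: finite_finset.
move=> p /= size_p; exists [ffun m : 'X_{1..2 < d} => p@_m] => //.
by rewrite /g [RHS](mpolywE size_p); apply: eq_bigr => m _; rewrite ffunE.
Qed.

Definition irr_of_degree d : set {mpoly F[2]} :=
  (normalized_of_degree d `&` [set p | irreducible_elt p])%classic.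

Lemma finite_irr_of_degree d : finite_set (irr_of_degree d).
Proof. by apply: finite_setIl; apply: finite_normalized_of_degree. Qed.

(** The set [L] of polynomials of degree at most [d] strictly contains those counted by I(d), since
    it contains 0, and g -> h + g embeds it into those counted by I(d + 1). *)
Lemma I_ltS d : (I_ F d < I_ F d.+1)%N.
Proof.
pose L := [set p : {mpoly F[2]} | (msize p <= d.+1)%N]%classic.
have finL : finite_set L := finite_msize_le d.+1.
apply: (@leq_trans #|` fset_set L|).
  apply: fproper_ltn_card; rewrite fproperE; apply/andP; split.
    apply/fsubsetP => p; rewrite !in_fset_set //; last exact: finite_irr_of_degree.
    by rewrite !inE => -[[size_p _] _]; rewrite /L /= size_p.
  apply/fsubsetPn; exists 0; first by rewrite in_fset_set // inE /L /= msize0.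
  rewrite in_fset_set; last exact: finite_irr_of_degree.
  by apply/negP; rewrite inE => -[[]]; rewrite /has_degree msize0.
have [u0 u0_irr size_u0] := irreducible_poly_of_degree F (ltn0Sn d).
(* Making [u] monic gives [h + g] the coefficient 1 at x^(d+1), hence normalizes it. *)
pose u := (lead_coef u0)^-1 *: u0.
have lu0 : lead_coef u0 != 0 by rewrite lead_coef_eq0 -size_poly_eq0 size_u0.
have lu : lead_coef u = 1 by rewrite lead_coefZ mulVf.
have size_u : size u = d.+2 by rewrite size_scale ?invr_eq0.
have u_irr : irreducible_poly u.
  split=> [|q q_neq1]; first by rewrite size_u.
  rewrite dvdpZr ?invr_eq0 // => /u0_irr.2-/(_ q_neq1)/eqp_trans; apply.
  by rewrite eqp_sym; apply: eqp_scale; rewrite invr_eq0.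
pose h : {mpoly F[2]} := \sum_(i < d.+2) u`_i *: 'X_[mnm2 (val i) (d.+1 - i)%N].
have coef_h i : (i <= d.+1)%N -> h@_(mnm2 i (d.+1 - i)%N) = u`_i.
  move=> le_id; rewrite /h raddf_sum.
  rewrite (bigD1 (Ordinal (le_id : i < d.+2)%N)) //= big1 => [|j].
    by rewrite mcoeffZ mcoeffX eqxx mulr1 addr0.
  rewrite -val_eqE /= => neq_ji; rewrite mcoeffZ mcoeffX mnm2E !multinomE /=.
  by rewrite (negPf neq_ji) mulr0.
have size_h : (msize h <= d.+2)%N.
  apply: (leq_trans (msize_sum _ _ _)); apply/bigmax_leqP => i _.
  apply: leq_trans (msizeZ_le _ _) _; rewrite msizeX mdeg_mnm2 subnKC //.
  exact: ltn_ord i.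
have coef_hg g i : (msize g <= d.+1)%N -> (i <= d.+1)%N ->
    (h + g)@_(mnm2 i (d.+1 - i)%N) = u`_i.
  move=> size_g le_id; rewrite mcoeffD coef_h // [g@_ _]memN_msupp_eq0 ?addr0 //.
  by apply: msize_mdeg_ge; rewrite mdeg_mnm2 subnKC.
have u_last : u`_d.+1 = 1 by rewrite -lu lead_coefE size_u.
have lead_hg g : (msize g <= d.+1)%N -> (h + g)@_(mnm2 d.+1 0%N) = 1.
  by move=> size_g; have := coef_hg g d.+1 size_g (leqnn _); rewrite subnn u_last.
have size_hg g : (msize g <= d.+1)%N -> msize (h + g) = d.+2.
  move=> size_g; apply/eqP; rewrite eqn_leq (leq_trans (msizeD_le _ _)) /=; last first.
    by rewrite geq_max size_h ltnW.
  have: mnm2 d.+1 0%N \in msupp (h + g) by rewrite mcoeff_msupp lead_hg // oner_eq0.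
  by move/msize_mdeg_lt; rewrite mdeg_mnm2 addn0.
have <- : #|` [fset (h + g)%R | g in fset_set L]%fset| = #|` fset_set L|.
  by rewrite card_imfset //=; apply: addrI.
apply: fsubset_leq_card.
apply/fsubsetP => q /imfsetP[g] /=; rewrite in_fset_set // inE => size_g -> {q}.
rewrite in_fset_set; last exact: finite_irr_of_degree.
rewrite inE; split; first split.
- exact: size_hg.
- rewrite /normalized (@head_filter_mkseq _ _ _ _ _ 0%N) //.
    by rewrite subn0 lead_hg.
  by rewrite subn0 lead_hg // oner_eq0.
(* Since [g] does not reach degree [d.+1], the dehomogenized top form of [h + g] is that of [h]. *)
have topE : (top_poly2 (h + g))`_d.+1 = u.
  apply/polyP => i; rewrite coef_top_poly2; case: leqP => [le_id|lt_di].
    exact: coef_hg.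
  by rewrite nth_default // size_u.
by apply: (irreducible_top_form (size_hg g size_g)); rewrite ?topE.
Qed.

Lemma I_inj : injective (I_ F).
Proof.
have I_homo : {homo I_ F : i j / (i < j)%N}.
  by apply: homo_ltn I_ltS => i j k; apply: ltn_trans.
exact: incn_inj (leq_mono I_homo).
Qed.
End Normalized.

(** * Polynomials as multisets of irreducible polynomials *)

Section Count.
Variable F : finFieldType.
Implicit Types p q : {mpoly F[2]}.

Lemma msize_prod (s : seq {mpoly F[2]}) : {in s, forall p, p != 0} ->
  msize (\prod_(p <- s) p) = (\sum_(p <- s) (msize p).-1).+1.
Proof.
elim: s => [|p s IHs] s_neq0; first by rewrite !big_nil msize1.
have p_neq0 : p != 0 by apply: s_neq0; rewrite mem_head.
have {}s_neq0 : {in s, forall p, p != 0}.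
  by move=> q q_s; apply: s_neq0; rewrite inE q_s orbT.
rewrite !big_cons msizeM //; last by rewrite prodf_seq_neq0; apply/allP.
by rewrite IHs // addnS /= {1}(mpolySpred mdeg p_neq0).
Qed.

Lemma mleadc_prod (s : seq {mpoly F[2]}) :
  mleadc (\prod_(p <- s) p) = \prod_(p <- s) mleadc p.
Proof.
elim: s => [|p s IHs]; first by rewrite !big_nil mleadc1.
rewrite !big_cons -IHs; have [->|p_neq0] := eqVneq p 0.
  by rewrite !(mul0r, mleadc0).
have [->|q_neq0] := eqVneq (\prod_(q <- s) q) 0; first by rewrite !(mulr0, mleadc0).
by rewrite mleadcM_proper // mulf_neq0 ?mleadc_eq0.
Qed.

(** The cofactor is a nonzero constant, and comparing leading coefficients makes it 1. *)
Lemma normalized_associate p q : mleadc p = 1 -> mleadc q = 1 ->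
  irreducible_elt p -> irreducible_elt q -> divides p q -> p = q.
Proof.
move=> lp lq [_ p_nunit _] [_ _ q_irr] [c qE].
have [c_unit|/(negP p_nunit)//] := q_irr _ _ qE.
move: c_unit; rewrite mpoly_unitE => /msize_poly1P[a a_neq0 cE].
by move: lq; rewrite qE cE mul_mpolyC mleadcZE lp mulr1 => ->; rewrite scale1r.
Qed.

Variables (d k : nat).

(** These are the possible factors of a normalized polynomial of degree [d]; the leading coefficient
    expresses normalization for all degrees at once. *)
Definition monic_irr_le := [set p : {mpoly F[2]} |
  [/\ irreducible_elt p, mleadc p = 1 & (msize p <= d.+1)%N]]%classic.

Lemma finite_monic_irr_le : finite_set monic_irr_le.
Proof. by apply: sub_finite_set (finite_msize_le F d.+1) => p []. Qed.

Definition irr_fset : {fset {mpoly F[2]}} := fset_set monic_irr_le.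

Lemma irr_fsetP p : reflect [/\ irreducible_elt p, mleadc p = 1 & (msize p <= d.+1)%N]
  (p \in irr_fset).
Proof.
by rewrite in_fset_set ?inE; [exact: asboolP|exact: finite_monic_irr_le].
Qed.

Definition irr_deg (x : irr_fset) : 'I_d.+1 := inord (msize (val x)).-1.

Lemma irr_degE (x : irr_fset) : irr_deg x = (msize (val x)).-1 :> nat.
Proof.
rewrite inordK //; case: (irr_fsetP _ (valP x)) => [[x_neq0 _ _] _ size_x].
by rewrite -(mpolySpred mdeg x_neq0).
Qed.

Lemma irr_deg_gt0 x : (0 < irr_deg x)%N.
Proof.
rewrite irr_degE; case: (irr_fsetP _ (valP x)) => [[x_neq0]].
by rewrite mpoly_unitE (mpolySpred mdeg x_neq0) /= -lt0n.
Qed.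

Lemma card_irr_deg (e : 'I_d.+1) : #|[set x | irr_deg x == e]| = I_ F e.
Proof.
have -> : #|[set x | irr_deg x == e]| =
    #|` [fset val x | x in [set x | irr_deg x == e]]%fset|.
  by rewrite card_imfset ?cardE //; apply: val_inj.
congr #|` _|; apply/fsetP => p; rewrite in_fset_set; last first.
  exact: (@finite_irr_of_degree F e).
apply/imfsetP/asboolP => [[x] /=|].
  rewrite inE => /eqP xe ->; have [x_irr lx _] := irr_fsetP _ (valP x).
  have size_x : has_degree e (val x).
    have [x_neq0 _ _] := x_irr.
    by rewrite /has_degree -xe irr_degE -(mpolySpred mdeg x_neq0).
  by split=> //; split=> //; apply/(normalized_mleadc size_x).
move=> [[size_p /(normalized_mleadc size_p) lp] p_irr].
have p_Q : p \in irr_fset.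
  by apply/irr_fsetP; rewrite size_p; split=> //; apply: ltn_ord.
exists [` p_Q]%fset => //=; rewrite inE; apply/eqP/val_inj.
by rewrite /= irr_degE /= size_p.
Qed.

Lemma msize_prod_irr (s : seq irr_fset) :
  msize (\prod_(x <- s) val x) = (\sum_(x <- s) irr_deg x)%N.+1.
Proof.
rewrite -(big_map val xpredT id) msize_prod => [|p /mapP[x _ ->]]; last first.
  by have [[]] := irr_fsetP _ (valP x).
by rewrite big_map; congr S; apply: eq_bigr => x _; rewrite irr_degE.
Qed.

Lemma mleadc_prod_irr (s : seq irr_fset) : mleadc (\prod_(x <- s) val x) = 1.
Proof.
rewrite -(big_map val xpredT id) mleadc_prod big_map big1 // => x _.
by have [] := irr_fsetP _ (valP x).
Qed.

(** Unique factorization, with associates identified by normalization. *)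
Lemma prod_irr_inj (s t : seq irr_fset) :
  \prod_(x <- s) val x = \prod_(x <- t) val x -> perm_eq s t.
Proof.
rewrite -!(big_map val xpredT id) => stE; apply: (perm_map_inj val_inj).
apply: prime_factorization_unique stE => [p|p q].
  rewrite -map_cat => /mapP[x _ ->]; apply: irreducible_prime_mpoly2.
  by have [] := irr_fsetP _ (valP x).
move=> /mapP[x _ ->] /mapP[y _ ->].
have [x_irr lx _] := irr_fsetP _ (valP x); have [y_irr ly _] := irr_fsetP _ (valP y).
exact: normalized_associate.
Qed.

Lemma irreducible_scale_unit (c : F) p :
  c != 0 -> irreducible_elt p -> irreducible_elt (c *: p).
Proof.
move=> c_neq0 [p_neq0 p_nunit p_irr]; split.
- by rewrite mscalerI negb_or c_neq0.
- by rewrite mpoly_unitE msizeZ // -mpoly_unitE.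
move=> a b cpE; have [||] := p_irr (c^-1 *: a) b.
- by rewrite -scalerAl -cpE scalerA mulVf // scale1r.
- by rewrite !mpoly_unitE msizeZ ?invr_eq0 //; left.
- by right.
Qed.

(** Dividing every factor by its leading coefficient preserves the product, because these
    coefficients multiply to 1. *)
Lemma monic_factors (s : seq {mpoly F[2]}) : {in s, forall q, irreducible_elt q} ->
  mleadc (\prod_(q <- s) q) = 1 -> (msize (\prod_(q <- s) q) <= d.+1)%N ->
  exists2 t : seq irr_fset, size t = size s & \prod_(q <- s) q = \prod_(x <- t) val x.
Proof.
move=> s_irr l1 size_s.
have s_neq0 : {in s, forall q, q != 0} by move=> q /s_irr[].
pose m q := (mleadc q)^-1 *: q.
have mE : \prod_(q <- s) q = \prod_(q <- map m s) q.
  rewrite big_map scaler_prod prodfV -mleadc_prod l1 invr1 scale1r //.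
have m_Q q : q \in s -> m q \in irr_fset.
  move=> q_s; have q_neq0 := s_neq0 q q_s.
  apply/irr_fsetP; split.
  - by apply: irreducible_scale_unit (s_irr q q_s); rewrite invr_eq0 mleadc_eq0.
  - by rewrite mleadcZE mulVf // mleadc_eq0.
  rewrite msizeZ ?invr_eq0 ?mleadc_eq0 // (leq_trans _ size_s) //.
  rewrite (perm_big _ (perm_to_rem q_s)) big_cons msizeM //; last first.
    by rewrite prodf_seq_neq0; apply/allP => r /mem_rem/s_neq0.
  rewrite (mpolySpred mdeg q_neq0) msize_prod ?addnS ?ltnS ?leq_addr //.
  by move=> r /mem_rem/s_neq0.
have [t tE] : exists t : seq irr_fset, map val t = map m s.
  exists (pmap insub (map m s)); rewrite pmap_filter; last exact: insubK.
  by apply/all_filterP/allP => _ /mapP[q q_s ->]; rewrite /= insubT ?m_Q.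
exists t; first by rewrite -(size_map val) tE size_map.
by rewrite mE -tE big_map.
Qed.

(** Taking products is a bijection from multisets to polynomials: injective by unique factorization,
    surjective by rescaling the factors. *)
Lemma card_S : S_ F k d =
  #|[set f : {ffun irr_fset -> 'I_k.+1} | (size (seq_of_mult f) == k) &&
      (\sum_(x <- seq_of_mult f) irr_deg x == d)%N]|.
Proof.
set A := [set f : {ffun irr_fset -> 'I_k.+1} | _ ].
pose M (f : {ffun irr_fset -> 'I_k.+1}) := \prod_(x <- seq_of_mult f) val x.
have M_inj : injective M by move=> f g /prod_irr_inj /seq_of_mult_inj.
have -> : #|A| = #|` [fset M f | f in A]%fset| by rewrite card_imfset ?cardE.
congr #|` _|; apply/fsetP => p; rewrite in_fset_set; last first.
  by apply: finite_setIl; apply: finite_normalized_of_degree.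
apply/asboolP/imfsetP => [[[size_p np] [s [s_irr pE]]]|[f /= Af ->]].
  have lp := (normalized_mleadc size_p).1 np; rewrite pE in lp size_p.
  have [|t size_t stE] := monic_factors s_irr lp; first by rewrite size_p.
  have size_tk : size t = k by rewrite size_t size_tuple.
  have perm_t := seq_of_mult_count (eq_leq size_tk).
  exists [ffun x => inord (count_mem x t)]; last by rewrite pE stE /M (perm_big _ perm_t).
  rewrite /= inE (perm_size perm_t) size_tk eqxx (perm_big _ perm_t) /=.
  by rewrite -eqSS -msize_prod_irr -stE size_p.
move: Af; rewrite inE => /andP[size_f /eqP sum_f].
have size_Mf : has_degree d (M f) by rewrite /has_degree msize_prod_irr sum_f.
split; first by split=> //; apply/(normalized_mleadc size_Mf)/mleadc_prod_irr.
have size_s : size (map val (seq_of_mult f)) == k by rewrite size_map.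
exists (Tuple size_s); split=> [q /mapP[x _ ->]|]; last by rewrite big_map.
by have [] := irr_fsetP _ (valP x).
Qed.
End Count.

Theorem lemma4 (p n : nat) (F : finFieldType)
    (hp : prime p) (hn : (1 <= n)%N) (hF : #|F| = (p ^ n)%N)
    (d k : nat) (hd : (1 <= d)%N) (hk : (1 <= k)%N) :
  S_ F k d =
    (\sum_(t in partitions k d) otimes [seq I_ F (val i) | i <- t])%N.
Proof.
rewrite card_S card_multisets_partition; last exact: irr_deg_gt0.
(* Here injectivity of I lets [otimes] group equal degrees. *)
apply: eq_bigr => t _; rewrite (otimes_map (g := fun i : 'I_d.+1 => I_ F (val i))).
  by apply: eq_bigr => e _; rewrite card_irr_deg.
by move=> i j /I_inj; apply: val_inj.
Qed.
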